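(* There exists a locally Lipschitz function $H\colon\mathbb{R}^{4\times 4}_{\mathrm{sym}}\to[0,\infty)$ which is convex along symmetric rank-one directions, in the sense that $t\mapsto H(A+t\,a\otimes a)$ is convex on $\mathbb{R}$ for every $A\in\mathbb{R}^{4\times 4}_{\mathrm{sym}}$ and every $a\in\mathbb{R}^4$, but which is not Hessian-quasiconvex at $0$: there exists $\psi\in C^\infty(\mathbb{T}^4)$ (real-valued) such that $$\frac{1}{|\mathbb{T}^4|}\int_{\mathbb{T}^4}H(D^2\psi)\,dx<H(0).$$
   Context: $\mathbb{R}^{4\times 4}_{\mathrm{sym}}$ is the space of real symmetric $4\times 4$ matrices, $a\otimes a=aa^T$, $\mathbb{T}^4$ is the periodic torus (e.g. $\mathbb{R}^4/(2\pi\mathbb{Z})^4$), and $D^2\psi$ is the Hessian matrix of $\psi$. *)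

(* Defs.v *)
From HB Require Import structures.
From mathcomp Require Import all_boot all_order all_algebra.
From mathcomp Require Import all_classical all_reals all_analysis.
From mathcomp Require Import sesquilinear.

Set Implicit Arguments.
Unset Strict Implicit.
Unset Printing Implicit Defensive.

Import Order.TTheory GRing.Theory Num.Theory.
Import numFieldNormedType.Exports.

Local Open Scope classical_set_scope.
Local Open Scope ring_scope.

Definition symmetric_set (R : realType) (n : nat) : set 'M[R]_n :=
  [set A | A \is symmetricmx].
Arguments symmetric_set R n : clear implicits.

Definition basis_vec (R : realType) (n : nat) (i : 'I_n) : 'cV[R]_n :=
  delta_mx i 0.

(* [:: i1; ...; ik] is sent to D_i1 (... (D_ik f)). *)
Definition partials (R : realType) (n : nat) (s : seq 'I_n)
    (f : 'cV[R]_n -> R) : 'cV[R]_n -> R :=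
  foldr (fun i g => 'D_(basis_vec R i) g) f s.

(* Since 'D is total, existence of each derivative is required separately. *)
Definition smooth (R : realType) (n : nat) (f : 'cV[R]_n -> R) : Prop :=
  forall s : seq 'I_n, continuous (partials s f) /\
    forall (i : 'I_n) (x : 'cV[R]_n),
      derivable (partials s f) x (basis_vec R i).

Definition hessian (R : realType) (n : nat) (f : 'cV[R]_n -> R)
    (x : 'cV[R]_n) : 'M[R]_n :=
  \matrix_(i, j) partials [:: i; j] f x.

(* C^oo(T^n), for T^n = R^n / (2 pi Z)^n, as smooth functions on R^n that are
   2 pi-periodic in each coordinate. *)
Definition smooth_torus (R : realType) (n : nat) (f : 'cV[R]_n -> R) : Prop :=
  smooth f /\ forall i : 'I_n, periodic f ((2 * pi) *: basis_vec R i).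

Lemma product_sigma_finite d1 d2 (T1 : measurableType d1)
    (T2 : measurableType d2) (R : realType)
    (m1 : {sigma_finite_measure set T1 -> \bar R})
    (m2 : {sigma_finite_measure set T2 -> \bar R}) :
  sigma_finite setT (m1 \x m2)%E.
Proof.
have /sigma_finiteP[F [TF ndF Foo]] := sigma_finiteT m1.
have /sigma_finiteP[G [TG ndG Goo]] := sigma_finiteT m2.
exists (fun n => F n `*` G n).
  rewrite -setXTT TF TG predeqE => -[x y]; split.
    move=> [/= [n _ Fnx] [k _ Gky]]; exists (maxn n k) => //; split.
    - by move: x Fnx; exact/subsetPset/ndF/leq_maxl.
    - by move: y Gky; exact/subsetPset/ndG/leq_maxr.
  by move=> [n _ []/= ? ?]; split; exists n.
move=> k; have [? ?] := Foo k; have [? ?] := Goo k.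
split; first exact: measurableX.
by rewrite product_measure1E// lte_mul_pinfty// ge0_fin_numE.
Qed.

(* Lebesgue measure on R^2 and R^4, modelled as iterated pairs because the
   library puts no measurable structure on matrices. The sigma-finite
   instances of products are not inferred through "\x", hence the constants. *)
Definition lebesgue2 (R : realType) :
    set (measurableTypeR R * measurableTypeR R) -> \bar R :=
  (@lebesgue_measure R \x @lebesgue_measure R)%E.
Arguments lebesgue2 R : clear implicits.

HB.instance Definition _ (R : realType) := Measure.on (lebesgue2 R).
HB.instance Definition _ (R : realType) :=
  Measure_isSigmaFinite.Build _ _ _ (lebesgue2 R)
    (product_sigma_finite (@lebesgue_measure R) (@lebesgue_measure R)).

Definition lebesgue4 (R : realType) :
    set ((measurableTypeR R * measurableTypeR R) *
         (measurableTypeR R * measurableTypeR R)) -> \bar R :=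
  (lebesgue2 R \x lebesgue2 R)%E.
Arguments lebesgue4 R : clear implicits.

HB.instance Definition _ (R : realType) := Measure.on (lebesgue4 R).
HB.instance Definition _ (R : realType) :=
  Measure_isSigmaFinite.Build _ _ _ (lebesgue4 R)
    (product_sigma_finite (lebesgue2 R) (lebesgue2 R)).

Definition col4 (R : realType) (x : (R * R) * (R * R)) : 'cV[R]_4 :=
  \col_i [:: x.1.1; x.1.2; x.2.1; x.2.2]`_i.

(* A fundamental domain of T^4, up to a null set. *)
Definition cell4 (R : realType) : set ((R * R) * (R * R)) :=
  (`[0, 2 * pi] `*` `[0, 2 * pi]) `*` (`[0, 2 * pi] `*` `[0, 2 * pi]).
Arguments cell4 R : clear implicits.

Definition torus4_mean (R : realType) (g : 'cV[R]_4 -> R) : \bar R :=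
  ((fine (lebesgue4 R (cell4 R)))^-1%:E
     * \int[lebesgue4 R]_(x in cell4 R) (g (col4 x))%:E)%E.

(* Main.v *)
Require Import Defs.
From HB Require Import structures.
From mathcomp Require Import all_boot all_order all_algebra.
From mathcomp Require Import all_classical all_reals all_analysis.
From mathcomp Require Import sesquilinear measurable_realfun ring lra.

Import Order.TTheory GRing.Theory Num.Theory.
Import numFieldNormedType.Exports.

Local Open Scope classical_set_scope.
Local Open Scope ring_scope.

(** Take the four frequencies e1, e2, e3 and e1 + e2 + e3, and let L be the
    span of the four matrices k (x) k (all computations take place in the upper
    left 3 x 3 block). A matrix of L with coordinates u, v, w on the e_i (x) e_i
    and d on the last one has diagonal (u + d, v + d, w + d) and all its
    off-diagonal entries equal to d, so it has the form a (x) a only if it is a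
    multiple of one of the four generators. Hence - u v w d is affine along
    every symmetric rank-one direction of L. On the other hand
    psi = cos x1 + cos x2 + cos x3 + cos (x1 + x2 + x3) has its Hessian in L,
    with minus the four cosines as coordinates, and the resonance
    k4 = k1 + k2 + k3 makes the mean of their product equal to 1/8, not 0.

    Outside L, two more coordinates p = A02 - A01 and q = A12 - A01 measure the
    distance to L, and the function
      H = 1 - u v w d + (u^2 + v^2 + w^2 + d^2)^3 + 6 (p^2 + q^2)
    is convex along all symmetric rank-one directions. The reason is algebraic:
    at a (x) a the deviations P and Q are two conics in a meeting exactly in
    the four frequencies, so the product of any two of the four coordinates of
    a (x) a, which vanishes at these points, is a combination of P and Q with
    quadratic coefficients. The second derivative of - u v w d is therefore
    - 2 (P X + Q Z) with X and Z at most of order |a|^2 |(u, v, w, d)|^2, and is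
    absorbed by those of 6 (p^2 + q^2) and of the sextic term
    ([second_variation_ge0]). The sextic term also bounds H from below
    ([energy_ge0]).

    For l psi, the product term contributes - l^4 / 8 to the mean of H
    ([integral_cos_product]) and the sextic one at most 64 l^6, so that a small
    amplitude l brings the mean strictly below H 0 = 1. *)

(** * The energy and its second variation *)

(** The integrand in coordinates: u, v, w, d are the components on the four
    generators of L, and p, q vanish exactly on L. It is defined over any
    commutative ring because it is also evaluated on polynomials in the
    parameter of a line. *)
Definition energy (S : comNzRingType) (u v w d p q : S) : S :=
  1 - u * v * w * d + (u ^+ 2 + v ^+ 2 + w ^+ 2 + d ^+ 2) ^+ 3
  + 6%:R * (p ^+ 2 + q ^+ 2).
Arguments energy {S}.

(** The second derivative of [energy] at (u, v, w, d, p, q) in the direction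
    (U, V, W, D, P, Q). *)
Definition second_variation {S : comNzRingType} (u v w d U V W D P Q : S) : S :=
  - (2%:R * (U * V * (w * d) + U * W * (v * d) + U * D * (v * w)
       + V * W * (u * d) + V * D * (u * w) + W * D * (u * v)))
  + (6%:R * (u ^+ 2 + v ^+ 2 + w ^+ 2 + d ^+ 2) ^+ 2
       * (U ^+ 2 + V ^+ 2 + W ^+ 2 + D ^+ 2)
     + 24%:R * (u ^+ 2 + v ^+ 2 + w ^+ 2 + d ^+ 2)
       * (u * U + v * V + w * W + d * D) ^+ 2)
  + 12%:R * (P ^+ 2 + Q ^+ 2).

Lemma energy_ge0 (R : realFieldType) (u v w d p q : R) :
  0 <= energy u v w d p q.
Proof.
rewrite /energy; set n := u ^+ 2 + _ + _ + _.
have n0 : 0 <= n by rewrite /n; nra.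
have prod_le : u * v * w * d <= n ^+ 2.
  have h1 : `|u * v| <= n by rewrite ler_norml /n; apply/andP; split; nra.
  have h2 : `|w * d| <= n by rewrite ler_norml /n; apply/andP; split; nra.
  rewrite -[_ * w * d]mulrA (le_trans (ler_norm _))// normrM expr2.
  exact: ler_pM.
have cube : 0 <= 1 - n ^+ 2 + n ^+ 3 by have [|] := leP n 1; nra.
nra.
Qed.

Lemma cauchy3 (R : realFieldType) (a b c x y z : R) :
  (a * x + b * y + c * z) ^+ 2 <=
  (a ^+ 2 + b ^+ 2 + c ^+ 2) * (x ^+ 2 + y ^+ 2 + z ^+ 2).
Proof.
rewrite -subr_ge0 [leRHS](_ : _ = (a * y - b * x) ^+ 2 + (a * z - c * x) ^+ 2
  + (b * z - c * y) ^+ 2); last by ring.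
by rewrite !addr_ge0 ?sqr_ge0.
Qed.

Lemma cauchy2 (R : realFieldType) (a b x y : R) :
  (a * x + b * y) ^+ 2 <= (a ^+ 2 + b ^+ 2) * (x ^+ 2 + y ^+ 2).
Proof.
by have := @cauchy3 _ a b 0 x y 0; rewrite mul0r expr0n /= !addr0.
Qed.

(** In this section U, V, W, D, P, Q are the coordinates of a (x) a for
    a = (x, y, z). *)
Section rank_one_direction.
Variables (R : realFieldType) (u v w d x y z : R).
Let U := x ^+ 2 - x * y.
Let V := y ^+ 2 - x * y.
Let W := z ^+ 2 - x * y.
Let D := x * y.
Let P := x * z - x * y.
Let Q := y * z - x * y.
Let n := u ^+ 2 + v ^+ 2 + w ^+ 2 + d ^+ 2.
Let s := x ^+ 2 + y ^+ 2 + z ^+ 2.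
Let cross := U * V * (w * d) + U * W * (v * d) + U * D * (v * w)
  + V * W * (u * d) + V * D * (u * w) + W * D * (u * v).
Let X := (x - y) * (z * (v * d) - y * (w * d) - y * (u * d))
  + y * (x * (v * w) - y * (u * w) + z * (u * v)).
Let Z := (x - y) * (x * (w * d) + x * (v * d) - z * (u * d))
  + x * (y * (u * w) + y * (u * v) - x * (v * w)).

(* Each product of two coordinates lies in the ideal generated by P and Q:
   U V = (x - y) (x Q - y P), U W = (x - y) (z P + x Q), U D = x (y P - x Q),
   V W = (y - x) (y P + z Q), V D = y (x Q - y P), W D = y z P + x y Q. *)
Let crossE : cross = P * X + Q * Z.
Proof. rewrite /cross /P /Q /X /Z /U /V /W /D; ring. Qed.

(* The four coordinates control a (x) a, as s = U + V + W + 3 D. *)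
Let sY : s ^+ 2 <= 12%:R * (U ^+ 2 + V ^+ 2 + W ^+ 2 + D ^+ 2).
Proof.
have -> : s = U + V + W + 3%:R * D by rewrite /s /U /V /W /D; ring.
rewrite -subr_ge0 [leRHS](_ : _ = (U - V) ^+ 2 + (U - W) ^+ 2 + (V - W) ^+ 2
  + (3%:R * U - D) ^+ 2 + (3%:R * V - D) ^+ 2
  + (3%:R * W - D) ^+ 2); last by ring.
by rewrite !addr_ge0 ?sqr_ge0.
Qed.

Let m := (v * d) ^+ 2 + (w * d) ^+ 2 + (u * d) ^+ 2
   + ((v * w) ^+ 2 + (u * w) ^+ 2 + (u * v) ^+ 2).

Let m_le : 2%:R * m <= n ^+ 2.
Proof.
rewrite -subr_ge0 [leRHS](_ : _ = u ^+ 4 + v ^+ 4 + w ^+ 4 + d ^+ 4);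
  last by rewrite /n /m; ring.
by rewrite !addr_ge0// -[4%N]/(2 * 2)%N exprM sqr_ge0.
Qed.

(* The common shape of X (with t = y) and of Z (with t = x). *)
Let bound (t a b c a' b' c' : R) :
  t ^+ 2 <= s -> a ^+ 2 + b ^+ 2 + c ^+ 2 <= 2%:R * s ->
  a' ^+ 2 + b' ^+ 2 + c' ^+ 2 <= 2%:R * s ->
  ((x - y) * (a * (v * d) + b * (w * d) + c * (u * d))
    + t * (a' * (v * w) + b' * (u * w) + c' * (u * v))) ^+ 2
  <= 3%:R * (s * n) ^+ 2.
Proof.
move=> ts abc abc'.
have s0 : 0 <= s by rewrite /s; nra.
apply: le_trans (cauchy2 _ _ _ _ _) _.
have h1 : (x - y) ^+ 2 + t ^+ 2 <= 3%:R * s.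
  rewrite /s in ts *; have := sqr_ge0 (x + y); have := sqr_ge0 z; lra.
have h2 : (a * (v * d) + b * (w * d) + c * (u * d)) ^+ 2
  + (a' * (v * w) + b' * (u * w) + c' * (u * v)) ^+ 2 <= 2%:R * s * m.
  rewrite /m mulrDr; apply: lerD; apply: le_trans (cauchy3 _ _ _ _ _ _ _) _;
    by rewrite ler_wpM2r// !addr_ge0 ?sqr_ge0.
apply: (@le_trans _ _ (3%:R * s * (2%:R * s * m))).
  by apply: ler_pM => //; rewrite addr_ge0// sqr_ge0.
rewrite [leLHS](_ : _ = 3%:R * s ^+ 2 * (2%:R * m)); last by ring.
by rewrite [(s * n) ^+ 2]exprMn [leRHS]mulrA ler_wpM2l// mulr_ge0// sqr_ge0.
Qed.

(** The cross term P X + Q Z is split by Young's inequality: the squares of P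
    and Q go into the penalty, those of X and Z into the Hessian of the sextic
    term, because X^2 and Z^2 are at most 3 |a|^4 n^2. *)
Lemma second_variation_ge0 :
  0 <= second_variation u v w d U V W D P Q.
Proof.
rewrite /second_variation -/n -/cross.
have xs : x ^+ 2 <= s by rewrite /s; nra.
have ys : y ^+ 2 <= s by rewrite /s; nra.
have zs : 0 <= z ^+ 2 by exact: sqr_ge0.
have X2 : X ^+ 2 <= 3%:R * (s * n) ^+ 2.
  have := @bound y z (- y) (- y) x (- y) z ys.
  rewrite !sqrrN !mulNr; apply; rewrite /s; nra.
have Z2 : Z ^+ 2 <= 3%:R * (s * n) ^+ 2.
  have := @bound x x x (- z) (- x) y y xs.
  rewrite !sqrrN !mulNr => h; apply: le_trans (h _ _); last 2 first.
  - rewrite /s; nra.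
  - rewrite /s; nra.
  by rewrite le_eqVlt /Z; apply/orP; left; apply/eqP; ring.
have n0 : 0 <= n by rewrite /n; nra.
have sYn : 6%:R * (s * n) ^+ 2 <=
    72%:R * (n ^+ 2 * (U ^+ 2 + V ^+ 2 + W ^+ 2 + D ^+ 2)).
  rewrite exprMn [s ^+ 2 * _]mulrC.
  have := ler_wpM2l (sqr_ge0 n) sY; lra.
have last : 0 <= n * (u * U + v * V + w * W + d * D) ^+ 2.
  by rewrite mulr_ge0 ?sqr_ge0.
rewrite crossE; move: X2 Z2 sYn last.
move: (U ^+ 2 + _ + _ + _) (u * U + _ + _ + _) (s * n) n0 => E G sn.
generalize n X Z P Q => N X0 Z0 P0 Q0 N0 X2 Z2 sYn last.
(* (12 P - X)^2 / 12 >= 0 bounds 2 P X by 12 P^2 + X^2 / 12 *)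
have := sqr_ge0 (12%:R * P0 - X0); have := sqr_ge0 (12%:R * Q0 - Z0).
lra.
Qed.
End rank_one_direction.

(** * Convexity along symmetric rank-one directions *)

Lemma convex_horner (R : realType) (p : {poly R}) :
  (forall t, 0 <= p^`()^`().[t]) ->
  convex_function setT (fun t : R^o => p.[t]).
Proof.
move=> ddp t x y _ _.
have D (r : {poly R}) : 'D_1 (horner r) = horner r^`().
  by apply/funext => z; rewrite derive_val.
have dr (r : {poly R}) z : derivable (horner r) z 1 by exact: ex_derive.
wlog xy : t x y / x <= y => [th|].
  have [/th|/ltW/th h] := leP x y; first by apply.
  by rewrite convC [leRHS]convC; apply: h.
apply: (@second_derivative_convex R (horner p)) => //.
- by move=> z _; rewrite D derive_val.
- exact/cvg_at_left_filter/continuous_horner.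
- exact/cvg_at_right_filter/continuous_horner.
- by move=> z _; rewrite D; exact: dr.
Qed.

Local Notation hE := (hornerD, hornerN, hornerM, hornerC, hornerX)
  (only parsing).

Definition line_poly {R : nzRingType} (u U : R) : {poly R} := u%:P + U%:P * 'X.

Lemma line_poly_horner (R : comNzRingType) (u U t : R) :
  (line_poly u U).[t] = u + t * U.
Proof. by rewrite /line_poly !hE mulrC. Qed.

Lemma line_poly_deriv (R : comNzRingType) (u U : R) :
  (line_poly u U)^`() = U%:P.
Proof.
by rewrite /line_poly derivD derivM !derivC derivX mul0r mulr1 !add0r.
Qed.

Lemma horner_energy (R : comNzRingType) (u v w d p q : {poly R}) t :
  (energy u v w d p q).[t] = energy u.[t] v.[t] w.[t] d.[t] p.[t] q.[t].
Proof. by rewrite /energy -!polyC_natr !hE; reflexivity. Qed.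

Lemma derivn2M (R : comNzRingType) (f g : {poly R}) :
  (f * g)^`()^`() = f^`()^`() * g + 2%:R * (f^`() * g^`()) + f * g^`()^`().
Proof. by rewrite !(derivM, derivD); ring. Qed.

Lemma line_poly_deriv2 (R : comNzRingType) (u U : R) :
  (line_poly u U)^`()^`() = 0.
Proof. by rewrite line_poly_deriv derivC. Qed.

Lemma energy_deriv2 (R : comNzRingType) (u v w d p q U V W D P Q t : R) :
  (energy (line_poly u U) (line_poly v V) (line_poly w W) (line_poly d D)
     (line_poly p P) (line_poly q Q))^`()^`().[t] =
  second_variation (u + t * U) (v + t * V) (w + t * W) (d + t * D) U V W D P Q.
Proof.
rewrite /energy.
have sq (x X : R) : (line_poly x X ^+ 2)^`()^`() = (2%:R * X ^+ 2)%:P.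
  rewrite expr2 derivn2M !line_poly_deriv !derivC !polyCM polyC_natr; ring.
have dsq (x X : R) : (line_poly x X ^+ 2)^`() = (2%:R * X)%:P * line_poly x X.
  rewrite expr2 derivM !line_poly_deriv !polyCM polyC_natr; ring.
set N := line_poly u U ^+ 2 + _ + _ + _.
have dN2 : N^`()^`() = (2%:R * (U ^+ 2 + V ^+ 2 + W ^+ 2 + D ^+ 2))%:P.
  by rewrite /N !derivD !sq -!polyCD -!mulrDr.
move: (line_poly_horner _ u U t) (line_poly_horner _ v V t).
move: (line_poly_horner _ w W t) (line_poly_horner _ d D t).
set ut := u + t * U; set vt := v + t * V.
set wt := w + t * W; set dt := d + t * D.
move: ut vt wt dt => ut vt wt dt wE dE uE vE.
have dN : N^`().[t] = 2%:R * (ut * U + vt * V + wt * W + dt * D).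
  by rewrite /N !derivD !dsq !(wE, dE, uE, vE, hE); ring.
have N0 : N.[t] = ut ^+ 2 + vt ^+ 2 + wt ^+ 2 + dt ^+ 2.
  by rewrite /N !(wE, dE, uE, vE, hE); ring.
clearbody N.
have cube : (N ^+ 3)^`()^`().[t] =
    6%:R * (ut ^+ 2 + vt ^+ 2 + wt ^+ 2 + dt ^+ 2) ^+ 2
      * (U ^+ 2 + V ^+ 2 + W ^+ 2 + D ^+ 2)
    + 24%:R * (ut ^+ 2 + vt ^+ 2 + wt ^+ 2 + dt ^+ 2)
      * (ut * U + vt * V + wt * W + dt * D) ^+ 2.
  rewrite exprS expr2 !derivn2M !derivM dN2 -!polyC_natr !hE dN N0; ring.
have quart :
    (line_poly u U * line_poly v V * line_poly w W
      * line_poly d D)^`()^`().[t] =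
    2%:R * (U * V * (wt * dt) + U * W * (vt * dt) + U * D * (vt * wt)
      + V * W * (ut * dt) + V * D * (ut * wt) + W * D * (ut * vt)).
  rewrite -mulrA !derivn2M !derivM !line_poly_deriv2 !line_poly_deriv.
  by rewrite -!polyC_natr !(wE, dE, uE, vE, hE); ring.
have quad :
    (6%:R * (line_poly p P ^+ 2 + line_poly q Q ^+ 2)
      : {poly R})^`()^`().[t]
    = 12%:R * (P ^+ 2 + Q ^+ 2).
  by rewrite -polyC_natr !deriv_mulC !derivD !sq !hE; ring.
move: quart cube quad; set f4 := _ * line_poly d D; set f6 := N ^+ 3.
set f2 := _ * (_ + _) => f4E f6E f2E.
rewrite !derivD !derivN !hornerD !hornerN f4E f6E f2E derivC deriv0 horner0.
by rewrite sub0r.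
Qed.

(** On 4 x 4 matrices the coordinates of [energy] are read off the upper left
    3 x 3 block: the common off-diagonal value on L is read at (0, 1), and p, q
    compare the two other off-diagonal entries with it. *)
Definition energy_mx {R : realType} (A : 'M[R]_4) : R :=
  energy (A 0 0 - A 0 1) (A 1 1 - A 0 1) (A 2 2 - A 0 1) (A 0 1)
    (A 0 2 - A 0 1) (A 1 2 - A 0 1).

Lemma energy_mx_rank_one_convex {R : realType} (A : 'M[R]_4) (a : 'cV[R]_4) :
  convex_function setT (fun t : R^o => energy_mx (A + t *: (a *m a^T))).
Proof.
have aaT i j : (a *m a^T) i j = a i 0 * a j 0 by rewrite mxE big_ord1 mxE.
pose x := a 0 0; pose y := a 1 0; pose z := a 2 0.
rewrite (_ : (fun t => _) = horner (energy
    (line_poly (A 0 0 - A 0 1) (x ^+ 2 - x * y))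
    (line_poly (A 1 1 - A 0 1) (y ^+ 2 - x * y))
    (line_poly (A 2 2 - A 0 1) (z ^+ 2 - x * y))
    (line_poly (A 0 1) (x * y))
    (line_poly (A 0 2 - A 0 1) (x * z - x * y))
    (line_poly (A 1 2 - A 0 1) (y * z - x * y)))).
  apply: convex_horner => t; rewrite energy_deriv2.
  exact: second_variation_ge0.
apply/funext => t; rewrite horner_energy !line_poly_horner /energy_mx.
have AtE i j : (A + t *: (a *m a^T)) i j = A i j + t * (a i 0 * a j 0).
  by rewrite mxE [X in _ + X]mxE aaT.
rewrite !AtE -/x -/y -/z.
by congr energy; ring.
Qed.

(** * Local Lipschitz continuity of polynomial functions *)

Section lipschitz_on_bounded.
Context {R : realType} {V : normedModType R}.
Implicit Types f g : V -> R.

(** Lipschitz continuity on bounded sets: unlike global Lipschitz continuity it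
    is stable under products, and it implies local Lipschitz continuity. *)
Definition lipschitz_bounded f := forall r : R, exists k : R, 0 <= k /\
  forall x y, `|x| <= r -> `|y| <= r -> `|f x - f y| <= k * `|x - y|.

Lemma lipschitz_bounded_le f r : lipschitz_bounded f ->
  exists b, 0 <= b /\ forall x, `|x| <= r -> `|f x| <= b.
Proof.
move=> /(_ `|r|) [k [k0 fk]]; exists (k * `|r| + `|f 0|); split => [|x xr].
  by rewrite addr_ge0// mulr_ge0.
rewrite -lerBlDr (le_trans (lerB_dist _ _))//.
have xr' : `|x| <= `|r| by rewrite (le_trans xr)// ler_norm.
rewrite (le_trans (fk x 0 _ _)) ?normr0// subr0.
by rewrite ler_wpM2l.
Qed.

Lemma lipschitz_bounded_cst (c : R) : lipschitz_bounded (fun=> c).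
Proof.
by move=> r; exists 0; split => // x y _ _; rewrite subrr normr0 mul0r.
Qed.

Lemma lipschitz_boundedD f g : lipschitz_bounded f -> lipschitz_bounded g ->
  lipschitz_bounded (fun x => f x + g x).
Proof.
move=> lf lg r; have [k [k0 fk]] := lf r; have [l [l0 gl]] := lg r.
exists (k + l); split => [|x y xr yr]; first exact: addr_ge0.
rewrite opprD addrACA mulrDl (le_trans (ler_normD _ _))// lerD//.
  exact: fk.
exact: gl.
Qed.

Lemma lipschitz_boundedM f g : lipschitz_bounded f -> lipschitz_bounded g ->
  lipschitz_bounded (fun x => f x * g x).
Proof.
move=> lf lg r; have [k [k0 fk]] := lf r; have [l [l0 gl]] := lg r.
have [b [b0 fb]] := lipschitz_bounded_le _ r lf.
have [c [c0 gc]] := lipschitz_bounded_le _ r lg.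
exists (b * l + c * k); split => [|x y xr yr];
  first by rewrite addr_ge0 ?mulr_ge0.
rewrite (_ : _ - _ = f x * (g x - g y) + g y * (f x - f y)); last by ring.
rewrite (le_trans (ler_normD _ _))// mulrDl !normrM -!mulrA.
by apply: lerD; apply: ler_pM => //; [exact: fb|exact: gl|exact: gc|exact: fk].
Qed.

Lemma lipschitz_boundedN f : lipschitz_bounded f ->
  lipschitz_bounded (fun x => - f x).
Proof.
move=> lf r; have [k [k0 fk]] := lf r; exists k; split => // x y xr yr.
by rewrite -opprD normrN; exact: fk.
Qed.

Lemma lipschitz_boundedX f n : lipschitz_bounded f ->
  lipschitz_bounded (fun x => f x ^+ n).
Proof.
move=> lf; elim: n => [|n ih]; first exact: lipschitz_bounded_cst.
under eq_fun do rewrite exprS; exact: lipschitz_boundedM.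
Qed.

Lemma lipschitz_bounded_locally f (S : set V) :
  lipschitz_bounded f -> [locally [lipschitz f x | x in S]].
Proof.
move=> lf [x0 y0] _; have [k [k0 fk]] := lf (`|x0| + `|y0| + 1).
exists k; split; first exact: num_real.
move=> M kM; rewrite /dominated_by /within /=.
have near1 (z : V) : \forall x \near z, `|x| <= `|z| + 1.
  apply: filterS (nbhsx_ballx z 1 ltr01) => x; rewrite -ball_normE /= => zx.
  by rewrite -lerBlDl (le_trans (lerB_dist _ _))// distrC ltW.
exists ([set x | `|x| <= `|x0| + 1], [set y | `|y| <= `|y0| + 1]) => /=.
  by split; exact: near1.
move=> [x y] /= [xx0 yy0] _; rewrite (le_trans (fk _ _ _ _))//.
- by rewrite (le_trans xx0)// lerD2r lerDl.
- by rewrite (le_trans yy0)// lerD2r lerDr.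
- by rewrite ler_wpM2r// ltW.
Qed.

End lipschitz_on_bounded.

Lemma lipschitz_bounded_entry {R : realType} m n (i : 'I_m.+1) (j : 'I_n.+1) :
  lipschitz_bounded (fun A : 'M[R]_(m.+1, n.+1) => A i j).
Proof.
move=> r; exists 1; split => // A B _ _.
have -> : A i j - B i j = (A - B) i j by rewrite !mxE.
rewrite mul1r [leRHS]/Num.norm/= mx_normE.
exact: (le_bigmax _ (fun ij => `|(A - B) ij.1 ij.2|%:nng) (i, j)).
Qed.

Lemma energy_mx_lipschitz {R : realType} : lipschitz_bounded (@energy_mx R).
Proof.
by do 20?[exact: lipschitz_bounded_entry | exact: lipschitz_bounded_cst
 | apply: lipschitz_boundedD | apply: lipschitz_boundedN
 | apply: lipschitz_boundedX | apply: lipschitz_boundedM].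
Qed.

(** * Trigonometric polynomials *)

(** Directional derivatives reduce to derivatives in one variable, for which
    the chain rule applies. *)
Lemma is_derive_line {R : numFieldType} {V W : normedModType R} (f : V -> W)
    (x v : V) (d : W) :
  is_derive (0 : R) 1 (fun h : R => f (h *: v + x)) d -> is_derive x v f d.
Proof.
move=> [fd dE]; split; first by apply/derivable1P.
rewrite -dE /derive; set g1 := fun h => h^-1 *: _; set g2 := fun h => h^-1 *: _.
suff -> : g1 = g2 by [].
by rewrite funeqE => h /=; rewrite /g1 /g2/= addr0 scale0r add0r [_%:A]mulr1.
Qed.

Section trigonometric_polynomials.
Context {R : realType} {m n : nat}.
Implicit Types (c : 'I_m -> R) (K : 'M[R]_(m, n)) (phi : R) (x : 'cV[R]_n).

(** The rows of K are the frequencies. With a single phase phi for all the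
    waves the class is stable under partial derivatives, since differentiating
    a cosine adds pi / 2 to its phase. *)
Definition trigp c K phi x : R := \sum_j c j * cos ((K *m x) j 0 + phi).

Lemma phase_shift K x i j h :
  (K *m (h *: basis_vec R i + x)) j 0 = h * K j i + (K *m x) j 0.
Proof. by rewrite mulmxDr -scalemxAr -colE mxE; congr +%R; rewrite !mxE. Qed.

Lemma is_derive_cos_affine (a b : R) : is_derive (0 : R) 1
  (fun h : R => cos (h * a + b)) (a * cos (b + pi / 2)).
Proof.
have d1 : is_derive (0 : R) 1 (fun h : R => h * a + b) a.
  have -> : (fun h : R => h * a + b) = id * cst a + cst b by [].
  by apply: is_derive_eq; rewrite scaler0 add0r addr0 /= [_ *: _]mulr1.
have := @is_derive1_comp R cos _ _ _ _ (is_derive_cos _) d1.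
by rewrite mul0r add0r cosDpihalf mulrC.
Qed.

Lemma is_derive_trigp c K phi x i : is_derive x (basis_vec R i) (trigp c K phi)
  (trigp (fun j => c j * K j i) K (phi + pi / 2) x).
Proof.
apply: is_derive_line.
have -> : (fun h : R => trigp c K phi (h *: basis_vec R i + x)) =
   \sum_j (fun h => c j * cos (h * K j i + ((K *m x) j 0 + phi))).
  apply/funext => h; rewrite fct_sumE /trigp; apply: eq_bigr => j _.
  by rewrite phase_shift addrA.
rewrite /trigp; apply: is_derive_sum => j.
rewrite -mulrA.
have := is_deriveZ (c j) (is_derive_cos_affine (K j i) ((K *m x) j 0 + phi)).
by rewrite [_ *: _]/GRing.scale/= addrA.
Qed.

Lemma continuous_sum_fun {T : topologicalType} {p : nat} (f : 'I_p -> T -> R) :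
  (forall i, continuous (f i)) -> continuous (fun t => \sum_i f i t).
Proof.
move=> cf; have -> : (fun t => \sum_i f i t) = \sum_i f i.
  by apply/funext => t; rewrite fct_sumE.
elim/big_ind : _ => [|g h cg ch t|i _]; [exact: cst_continuous| |exact: cf].
exact: (cvgD (cg t) (ch t)).
Qed.

Lemma trigp_continuous c K phi : continuous (trigp c K phi).
Proof.
have cK j : continuous (fun y : 'cV[R]_n => (K *m y) j 0).
  under eq_fun do rewrite mxE.
  apply: continuous_sum_fun => i y.
  apply: (@continuousM _ _ (cst (K j i)) (fun y : 'cV[R]_n => y i 0) y).
    exact: cst_continuous.
  exact: coord_continuous.
apply: continuous_sum_fun => j x.
apply: (@continuousM _ _ (cst (c j)) (fun y => cos ((K *m y) j 0 + phi)) x).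
  exact: cst_continuous.
apply: (@continuous_comp _ _ _ (fun y => (K *m y) j 0 + phi) cos).
  apply: (@continuousD _ _ _ (fun y : 'cV[R]_n => (K *m y) j 0) (cst phi)).
    exact: cK.
  exact: cst_continuous.
exact: continuous_cos.
Qed.

Lemma partials_trigp c K phi s : exists c' phi',
  partials s (trigp c K phi) = trigp c' K phi'.
Proof.
elim: s => [|i s [c' [phi' /= ->]]]; first by exists c, phi.
exists (fun j => c' j * K j i), (phi' + pi / 2); apply/funext => x.
by have := is_derive_trigp c' K phi' x i => h; rewrite derive_val.
Qed.

Lemma trigp_smooth c K phi : smooth (trigp c K phi).
Proof.
move=> s; have [c' [phi' ->]] := partials_trigp c K phi s.
split; first exact: trigp_continuous.
by move=> i x; have := is_derive_trigp c' K phi' x i => h; exact: ex_derive.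
Qed.

Lemma hessian_trigp c K x :
  hessian (trigp c K 0) x =
  \matrix_(i, i') (- \sum_j c j * K j i * K j i' * cos ((K *m x) j 0)).
Proof.
apply/matrixP => i i'; rewrite !mxE /partials /=.
have -> : 'D_(basis_vec R i') (trigp c K 0) =
    trigp (fun j => c j * K j i') K (0 + pi / 2).
  apply/funext => y; have h := is_derive_trigp c K 0 y i'.
  by rewrite derive_val.
have h := is_derive_trigp (fun j => c j * K j i') K (0 + pi / 2) x i.
rewrite derive_val /trigp -sumrN; apply: eq_bigr => j _.
by rewrite add0r -splitr cosDpi mulrN [c j * _ * _]mulrAC.
Qed.

Lemma trigp_periodic c K phi i : (forall j, exists k, K j i = k%:R) ->
  periodic (trigp c K phi) ((2 * pi) *: basis_vec R i).
Proof.
move=> Kint x; rewrite /trigp; apply: eq_bigr => j _; congr (_ * _).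
have [k Kk] := Kint j.
rewrite [x + _]addrC phase_shift Kk.
by rewrite -[RHS](periodicn (@cosD2pi R) k); congr cos; ring.
Qed.
End trigonometric_polynomials.

(** * Mean values over the torus *)

Section product_integral.
Context {d1 d2} {T1 : measurableType d1} {T2 : measurableType d2}.
Context {R : realType}.
Variable m1 : {sigma_finite_measure set T1 -> \bar R}.
Variable m2 : {sigma_finite_measure set T2 -> \bar R}.

Lemma integral_rectangle (A : set T1) (B : set T2) (f : T1 * T2 -> R) (M : R) :
  measurable A -> measurable B -> (m1 A < +oo)%E -> (m2 B < +oo)%E ->
  measurable_fun setT f -> (forall z, `|f z| <= M) ->
  (\int[m1 \x m2]_(z in A `*` B) (f z)%:E =
   \int[m2]_(y in B) \int[m1]_(x in A) (f (x, y))%:E)%E.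
Proof.
move=> mA mB Afin Bfin mf fM.
have mAB : measurable (A `*` B) by exact: measurableX.
have ABfin : ((m1 \x m2) (A `*` B) < +oo)%E.
  by rewrite product_measure1E// lte_mul_pinfty// ge0_fin_numE.
have intf : (m1 \x m2)%E.-integrable (A `*` B) (EFin \o f).
  apply: measurable_bounded_integrable => //.
  - exact: measurable_funS mf.
  - exists M; split; first exact: num_real.
    by move=> k Mk z _; exact: le_trans (fM z) (ltW Mk).
rewrite integral_mkcond -integral21_prod_meas1;
  last by rewrite -integrable_mkcond.
rewrite [RHS]integral_mkcond; apply: eq_integral => y _.
rewrite /fubini_G patchE; case: ifPn => yB.
  rewrite [RHS]integral_mkcond; apply: eq_integral => x _.
  by rewrite !patchE in_setX yB andbT.
by apply: integral0_eq => x _; rewrite patchE in_setX (negbTE yB) andbF.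
Qed.
End product_integral.

Section mean.
Context {R : realType}.
Let mu := @lebesgue_measure R.
Let T := `[0, 2 * pi : R]%classic.

Lemma pi2_gt0 : 0 < 2 * pi :> R. Proof. by rewrite mulr_gt0 ?pi_gt0. Qed.

Lemma lebesgue_period : mu T = (2 * pi)%:E.
Proof. by rewrite /mu/T lebesgue_measure_itv/= lte_fin pi2_gt0 oppr0 adde0. Qed.

Lemma measurable_period : measurable T. Proof. exact: measurable_itv. Qed.

Lemma lebesgue2_period : lebesgue2 R (T `*` T) = ((2 * pi) ^+ 2)%:E.
Proof.
rewrite /lebesgue2 product_measure1E; [|exact: measurable_period..].
rewrite [X in (X * X)%E](_ : _ = (2 * pi)%:E) -?EFinM//.
exact: lebesgue_period.
Qed.

Lemma lebesgue4_cell : lebesgue4 R (cell4 R) = ((2 * pi) ^+ 4)%:E.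
Proof.
rewrite /lebesgue4 /cell4 product_measure1E;
  [|by apply: measurableX; exact: measurable_period..].
rewrite [X in (X * X)%E](_ : _ = ((2 * pi) ^+ 2)%:E);
  last exact: lebesgue2_period.
by rewrite -EFinM -exprD.
Qed.

(** Since 2 cos x cos (x + b) = cos (2 x + b) + cos b, only cos b survives over
    a period. *)
Lemma integral_cos_cos (k b : R) :
  (\int[mu]_(x in T) (k * (cos x * cos (x + b)))%:E = (k * (pi * cos b))%:E)%E.
Proof.
pose F (x : R) : R := (k / 2) * (sin x * cos (x + b) + x * cos b).
have dc (x : R) :
    is_derive x (1 : R) (fun y : R => cos (y + b)) (- sin (x + b)).
  rewrite -[- sin _]mulr1; apply: (@is_derive1_comp R cos (shift b)).
  exact: is_derive_shift.
have dF (x : R) : is_derive x (1 : R) F (k * (cos x * cos (x + b))).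
  have dsc := is_deriveM (is_derive_sin x) (dc x).
  have dxb := is_deriveM (is_derive_id x (1 : R))
    (is_derive_cst (cos b) x (1 : R)).
  apply: (is_derive_eq (is_deriveZ (k / 2) (is_deriveD dsc dxb))).
  rewrite scaler0 add0r /= ![_ *: _]/GRing.scale/= mulr1.
  have -> : cos b = cos (x + b - x) by congr cos; ring.
  by rewrite [cos (x + b - x)]cosB; field.
have cF : continuous F.
  move=> x; apply/differentiable_continuous/derivable1_diffP.
  exact: ex_derive.
rewrite (@continuous_FTC2 _ (fun x => k * (cos x * cos (x + b))) F _ _ pi2_gt0).
- rewrite -EFinB /F sin0 mulrC [2 * pi]mulr_natl sin2pi.
  by congr EFin; field.
- apply/continuous_subspaceT => x.
  apply/differentiable_continuous/derivable1_diffP.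
  have -> : (fun y => k * (cos y * cos (y + b))) =
    k *: (@cos R * (fun y => cos (y + b))) by [].
  exact: ex_derive.
- split=> [x _||]; first exact: ex_derive.
    exact/cvg_at_right_filter/cF.
  exact/cvg_at_left_filter/cF.
- by move=> x _; rewrite derive1E derive_val.
Qed.

(** The product of the four waves, with the factors grouped so that
    [integral_cos_cos] applies to the first variable with b = x2 + x3. *)
Definition cos_product (z : (R * R) * (R * R)) : R :=
  cos z.1.2 * cos z.2.1 * (cos z.1.1 * cos (z.1.1 + (z.1.2 + z.2.1))).

Local Notation R4 := ((measurableTypeR R * measurableTypeR R) *
         (measurableTypeR R * measurableTypeR R))%type.

Lemma measurable_cos_comp (f : R4 -> R) :
  measurable_fun setT f -> measurable_fun setT (fun z => cos (f z)).
Proof.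
move=> mf; apply: (measurableT_comp _ mf).
exact: continuous_measurable_fun (@continuous_cos R).
Qed.

Lemma measurable_coord1 : measurable_fun setT (fun z : R4 => z.1.1 : R).
Proof. exact: (measurableT_comp measurable_fst measurable_fst). Qed.
Lemma measurable_coord2 : measurable_fun setT (fun z : R4 => z.1.2 : R).
Proof. exact: (measurableT_comp measurable_snd measurable_fst). Qed.
Lemma measurable_coord3 : measurable_fun setT (fun z : R4 => z.2.1 : R).
Proof. exact: (measurableT_comp measurable_fst measurable_snd). Qed.

Lemma measurable_cos_product : measurable_fun [set: R4] cos_product.
Proof.
have m1 := measurable_coord1; have m2 := measurable_coord2.
have m3 := measurable_coord3.
by apply: measurable_funM; apply: measurable_funM;
  apply: measurable_cos_comp => //;
  apply: measurable_funD => //; apply: measurable_funD.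
Qed.

Lemma cos_product_le1 z : `|cos_product z| <= 1.
Proof. by rewrite /cos_product !normrM ?mulr_ile1 ?mulr_ge0 ?cos_max. Qed.

(** Integrating x1, then x2, then x3 uses [integral_cos_cos] each time: the
    right-hand side of one step is the integrand of the next, with b = x2 + x3,
    then b = x3, then b = 0. *)
Lemma integral_cos_product :
  (\int[lebesgue4 R]_(z in cell4 R) (cos_product z)%:E = (2 * pi ^+ 4)%:E)%E.
Proof.
have mT := measurable_period.
have mTT : measurable (T `*` T) by exact: measurableX.
have Tfin : (mu T < +oo)%E by rewrite lebesgue_period ltry.
have TTfin : (lebesgue2 R (T `*` T) < +oo)%E by rewrite lebesgue2_period ltry.
have mc := measurable_cos_product.
rewrite [LHS](@integral_rectangle _ _ _ _ _ (lebesgue2 R) (lebesgue2 R)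
  _ _ _ 1 mTT mTT TTfin TTfin mc cos_product_le1).
have inner (y : R * R) :
    (\int[lebesgue2 R]_(x in T `*` T) (cos_product (x, y))%:E
     = (pi ^+ 2 * (cos y.1 * cos (y.1 + 0)))%:E)%E.
  have mcy : measurable_fun [set: measurableTypeR R * measurableTypeR R]
      (fun x => cos_product (x, y)).
    exact: (measurableT_comp mc (pair2_measurable y)).
  rewrite [LHS](@integral_rectangle _ _ _ _ _ mu mu T T _ 1
    mT mT Tfin Tfin mcy); last first.
    by move=> z; exact: cos_product_le1.
  transitivity (\int[mu]_(t in T)
      (pi * cos y.1 * (cos t * cos (t + y.1)))%:E)%E.
    apply: eq_integral => t _.
    rewrite [LHS](integral_cos_cos (cos t * cos y.1) (t + y.1)).
    by congr EFin; ring.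
  by rewrite integral_cos_cos addr0; congr EFin; ring.
transitivity (\int[lebesgue2 R]_(y in T `*` T)
    (pi ^+ 2 * (cos y.1 * cos (y.1 + 0)))%:E)%E.
  by apply: eq_integral => y _; exact: inner.
have mcos := continuous_measurable_fun (@continuous_cos R).
rewrite [LHS](@integral_rectangle _ _ _ _ _ mu mu T T
  (fun y => pi ^+ 2 * (cos y.1 * cos (y.1 + 0))) (pi ^+ 2)
  mT mT Tfin Tfin); last 2 first.
- apply: measurable_funM => //; apply: measurable_funM.
    exact: (measurableT_comp mcos measurable_fst).
  under eq_fun do rewrite addr0.
  exact: (measurableT_comp mcos measurable_fst).
- move=> y; rewrite addr0 normrM ger0_norm ?sqr_ge0// ler_piMr ?sqr_ge0//.
  by rewrite normrM mulr_ile1 ?cos_max.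
transitivity (\int[mu]_(t in T) (cst (pi ^+ 3)%:E t))%E.
  apply: eq_integral => t _; rewrite /=.
  rewrite [LHS](integral_cos_cos (pi ^+ 2) 0) cos0; congr EFin; ring.
rewrite integral_cst// [X in (_ * X)%E](_ : _ = (2 * pi)%:E);
  last exact: lebesgue_period.
by rewrite -EFinM; congr EFin; ring.
Qed.
End mean.

Section counterexample.
Context {R : realType}.
Local Notation R4 := ((measurableTypeR R * measurableTypeR R) *
         (measurableTypeR R * measurableTypeR R))%type.

(** The mean of [cos_product] is 2 pi^4 / (2 pi)^4 = 1 / 8. *)
Lemma torus4_mean_le (g : 'cV[R]_4 -> R) (b k : R) :
  measurable_fun setT (fun z : R4 => g (col4 z)) ->
  (forall z, 0 <= g (col4 z) <= b - k * cos_product z) ->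
  (torus4_mean g <= (b - k / 8)%:E)%E.
Proof.
move=> mg gb.
have mT := @measurable_period R.
have mcell : measurable (cell4 R : set R4).
  by apply: measurableX; exact: measurableX.
have fcell : (lebesgue4 R (cell4 R) < +oo)%E by rewrite lebesgue4_cell ltry.
have pi4 : 0 < (2 * pi) ^+ 4 :> R by rewrite exprn_gt0// pi2_gt0.
have mcp := @measurable_cos_product R.
rewrite /torus4_mean lebesgue4_cell /=.
have mupper : measurable_fun setT (fun z : R4 => b - k * cos_product z).
  by apply: measurable_funB => //; exact: measurable_funM.
apply: (@le_trans _ _ ((((2 * pi) ^+ 4)^-1)%:E *
    \int[lebesgue4 R]_(z in cell4 R) (b - k * cos_product z)%:E)%E).
  rewrite lee_pmul2l// ?lte_fin ?invr_gt0//.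
  apply: ge0_le_integral => //.
  - by move=> z _; rewrite lee_fin; have /andP[] := gb z.
  - by apply/measurable_EFinP; apply: (measurable_funS measurableT _ mg).
  - by apply/measurable_EFinP; apply: (measurable_funS measurableT _ mupper).
  - by move=> z _; rewrite lee_fin; have /andP[] := gb z.
have bounded_integrable (h : R4 -> R) (M : R) : measurable_fun setT h ->
    (forall z, `|h z| <= M) -> (lebesgue4 R).-integrable (cell4 R) (EFin \o h).
  move=> mh hM; apply: measurable_bounded_integrable => //.
    exact: measurable_funS mh.
  exists M; split; first exact: num_real.
  by move=> N MN z _; exact: le_trans (hM z) (ltW MN).
have icp := bounded_integrable _ _ mcp cos_product_le1.
have -> : (\int[lebesgue4 R]_(z in cell4 R) (b - k * cos_product z)%:E =
   (b * (2 * pi) ^+ 4 - k * (2 * pi ^+ 4))%:E)%E.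
  under eq_integral => z _ do rewrite EFinB EFinM.
  rewrite integralB//; last 2 first.
  - exact: (bounded_integrable (cst b) `|b|).
  - exact: integrableZl.
  rewrite integralZl// integral_cos_product integral_cst//.
  rewrite [X in (_ * X - _)%E](_ : _ = ((2 * pi) ^+ 4)%:E);
    last exact: lebesgue4_cell.
  by rewrite -!EFinM -EFinB.
rewrite -EFinM lee_fin le_eqVlt; apply/orP; left; apply/eqP.
have pi0 : pi != 0 :> R by rewrite gt_eqF ?pi_gt0.
by move: (@pi R) pi0 => p p0; field.
Qed.

(** * The test function and its mean energy *)

(** The rows, indexed by j, are e1, e2, e3 and e1 + e2 + e3. *)
Definition frequencies : 'M[R]_4 :=
  \matrix_(j, i) (if (j < 3)%N then (i == j)%:R else (i < 3)%N%:R).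
Definition four_waves (l : R) := trigp (fun=> l) frequencies 0.

Lemma four_waves_smooth_torus l : smooth_torus (four_waves l).
Proof.
split; first exact: trigp_smooth.
move=> i; apply: trigp_periodic => j; rewrite mxE; case: ifP => _.
  by exists (i == j).
by exists (i < 3)%N.
Qed.

(** The Hessian of a sum of waves with frequencies k_j is a combination of the
    k_j (x) k_j, so that it stays in L; the two derivatives turn each cosine
    into its opposite. *)
Lemma energy_mx_hessian_four_waves l (z : R4) :
  energy_mx (hessian (four_waves l) (col4 z)) =
  energy (- l * cos z.1.1) (- l * cos z.1.2) (- l * cos z.2.1)
    (- l * cos (z.1.1 + (z.1.2 + z.2.1))) 0 0.
Proof.
have phase (j : 'I_4) : (frequencies *m col4 z) j 0 =
   [:: z.1.1; z.1.2; z.2.1; z.1.1 + (z.1.2 + z.2.1)]`_j.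
  rewrite !mxE !big_ord_recl big_ord0 !mxE /=.
  by case: j => [[|[|[|[|//]]]] ji] /=; rewrite ?(mul0r, mul1r, add0r, addr0).
rewrite /four_waves hessian_trigp /energy_mx !mxE.
rewrite !big_ord_recl !big_ord0 !phase !mxE /=.
rewrite !(mulr0, mul0r, mulr1, mul1r, add0r, addr0).
congr energy; ring.
Qed.

Lemma energy_waves_le (l a b c e : R) :
  `|a| <= 1 -> `|b| <= 1 -> `|c| <= 1 -> `|e| <= 1 ->
  energy (- l * a) (- l * b) (- l * c) (- l * e) 0 0 <=
  1 + 64 * l ^+ 6 - l ^+ 4 * (b * c * (a * e)).
Proof.
have sq1 (x : R) : `|x| <= 1 -> x ^+ 2 <= 1.
  by move=> x1; rewrite -real_normK ?num_real// expr_le1.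
move=> /sq1 a1 /sq1 b1 /sq1 c1 /sq1 e1; rewrite /energy.
set n := (- l * a) ^+ 2 + _ + _ + _.
have nE : n = l ^+ 2 * (a ^+ 2 + b ^+ 2 + c ^+ 2 + e ^+ 2) by rewrite /n; ring.
have n0 : 0 <= n by rewrite nE mulr_ge0 ?addr_ge0 ?sqr_ge0.
have n4 : n <= 4 * l ^+ 2 by rewrite nE mulrC ler_wpM2r ?sqr_ge0//; lra.
have n3 : n ^+ 3 <= (4 * l ^+ 2) ^+ 3.
  by rewrite lerXn2r ?nnegrE// mulr_ge0 ?sqr_ge0.
have -> : 64 * l ^+ 6 = (4 * l ^+ 2) ^+ 3 by ring.
rewrite expr0n/= addr0 mulr0 addr0.
have -> : - l * a * (- l * b) * (- l * c) * (- l * e) =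
  l ^+ 4 * (b * c * (a * e)) by ring.
lra.
Qed.

Lemma measurable_energy_mx_hessian_four_waves l :
  measurable_fun setT
    (fun z : R4 => energy_mx (hessian (four_waves l) (col4 z))).
Proof.
under eq_fun do rewrite energy_mx_hessian_four_waves /energy.
have m1 := @measurable_coord1 R; have m2 := @measurable_coord2 R.
have m3 := @measurable_coord3 R.
have mwave (h : R4 -> R) : measurable_fun setT h ->
    measurable_fun setT (fun z => - l * cos (h z)).
  by move=> mh; apply: measurable_funM => //; exact: measurable_cos_comp.
have mu := mwave _ m1; have mv := mwave _ m2; have mw := mwave _ m3.
have md := mwave _ (measurable_funD m1 (measurable_funD m2 m3)).
apply: measurable_funD => //; apply: measurable_funD.
  apply: measurable_funB => //.
  by do 3!apply: measurable_funM => //.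
apply: measurable_funX.
by do 3?apply: measurable_funD; apply: measurable_funX.
Qed.

(** At amplitude 1/32 the gain l^4 / 8 = 2^-23 exceeds the cost
    64 l^6 = 2^-24. *)
Lemma mean_energy_mx_lt :
  (torus4_mean (fun x => energy_mx (hessian (four_waves 32^-1) x)) <
   (energy_mx (0 : 'M[R]_4))%:E)%E.
Proof.
apply: le_lt_trans (torus4_mean_le _ (1 + 64 * 32^-1 ^+ 6) (32^-1 ^+ 4)
  (measurable_energy_mx_hessian_four_waves _) _) _.
  move=> z; rewrite {1}/energy_mx energy_ge0 /= energy_mx_hessian_four_waves.
  by apply: energy_waves_le; exact: cos_max.
rewrite lte_fin /energy_mx /energy !mxE !expr0n /=.
by lra.
Qed.

End counterexample.

Theorem corollary1p4 (R : realType) :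
  exists H : 'M[R]_4 -> R,
    [/\ [locally [lipschitz H A | A in symmetric_set R 4]],
        forall A : 'M[R]_4, symmetric_set R 4 A -> 0 <= H A,
        forall (A : 'M[R]_4) (a : 'cV[R]_4), symmetric_set R 4 A ->
          convex_function setT (fun t : R^o => H (A + t *: (a *m a^T)))
      & exists psi : 'cV[R]_4 -> R,
          smooth_torus psi /\
          (torus4_mean (fun x => H (hessian psi x)) < (H 0)%:E)%E].
Proof.
exists energy_mx; split.
- exact: lipschitz_bounded_locally energy_mx_lipschitz.
- by move=> A _; exact: energy_ge0.
- by move=> A a _; exact: energy_mx_rank_one_convex.
- exists (four_waves 32^-1); split; first exact: four_waves_smooth_torus.
  exact: mean_energy_mx_lt.
Qed.
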